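(* Let $V$ be a finite set with $|V|=n$, and let $K=\{x\in\mathbb{R}^{\mathcal{P}_1(V)}\mid a_l^Tx\ge0\ (l=1,\ldots,m)\}$, where $a_1,\ldots,a_m\in\mathbb{R}^{\mathcal{P}_1(V)}$, be contained in $\{x\in\mathbb{R}^{\mathcal{P}_1(V)}\mid 0\le x_i\le x_{\mathbf 0}\ (i\in V)\}$. Then for every integer $t\ge1$ with $t+1\le n+1$ the inclusion $L^{t+1}(K)\subseteq\widetilde L^t(K)$ holds.
   Context: For a finite set $V$ and an integer $r\ge0$, $\mathcal{P}_r(V)$ (resp. $\mathcal{P}_{=r}(V)$) is the collection of subsets of $V$ of cardinality at most $r$ (resp. exactly $r$). $\mathbf 0$ denotes the empty set and $\{i\}$ is identified with $i$. The standard unit vectors of $\mathbb{R}^{\mathcal{P}_1(V)}$ are $e_{\mathbf 0}$, $e_i$ ($i\in V$). ''$\succeq0$'' means ''is positive semidefinite''. For $S\subseteq V$ let $\mathcal{A}_S:=\{S\}\cup\{S\cup\{i\}\mid i\in V\}$ and for $T\subseteq V$ let $\mathcal{A}(T):=\bigcup_{S\subseteq T}\mathcal{A}_S$ (multisets, repetitions kept). For a vector $z$ with entries $z_I$ for all $I\in\mathcal{P}_{|T|+2}(V)$, $M(T;z)$ is the matrix indexed by $\mathcal{A}(T)$ with $(I,J)$-entry $z_{I\cup J}$. For $a\in\mathbb{R}^{\mathcal{P}_1(V)}$ and $y\in\mathbb{R}^{\mathcal{P}_{r}(V)}$ with $r\ge1$, the vector $ay\in\mathbb{R}^{\mathcal{P}_{r-1}(V)}$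 is defined by $(ay)_I:=a_{\mathbf 0}y_I+\sum_{i\in V}a_iy_{I\cup\{i\}}$. Block-diagonal hierarchy (defined with respect to the given description $a_1,\dots,a_m$ of $K$): for $t\ge2$, $L^t(K)$ is the set of all $x\in\mathbb{R}^{\mathcal{P}_1(V)}$ for which there exists $y\in\mathbb{R}^{\mathcal{P}_{t+1}(V)}$ with $y_{\mathbf 0}=x_{\mathbf 0}$, $y_i=x_i$ ($i\in V$), $M(T;y)\succeq0$ for all $T\in\mathcal{P}_{=(t-1)}(V)$, and $M(T;a_ly)\succeq0$ for all $T\in\mathcal{P}_{=(t-2)}(V)$ and $l=1,\ldots,m$. For $S\subseteq T$, $A_S(y)$ is the symmetric matrix indexed by $\mathcal{P}_1(V)$ with $A_S(y)_{\mathbf 0,\mathbf 0}=y_S$, $A_S(y)_{\mathbf 0,i}=y_{S\cup\{i\}}$, $A_S(y)_{i,j}=y_{S\cup\{i,j\}}$ ($i,j\in V$), and $A(S,T)(y):=\sum_{S':\,S\subseteq S'\subseteq T}(-1)^{|S'\setminus S|}A_{S'}(y)$. For $t\ge1$, $\widetilde L^t(K)$ is the set of all $x\in\mathbb{R}^{\mathcal{P}_1(V)}$ for which there exists $y\in\mathbb{R}^{\mathcal{P}_{t+1}(V)}$ such that $y_{\mathbf 0}=x_{\mathbf 0}$, $y_i=x_i$ ($i\in V$); $M(T;y)\succeq0$ for all $T\in\mathcal{P}_{=(t-1)}(V)$; and $A(S,T)(y)e_i\in K$, $A(S,T)(y)(e_{\mathbf 0}-e_i)\in K$ for all $T\in\mathcal{P}_{=(t-1)}(V)$,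 $S\subseteq T$, $i\in V$. *)

(* Defs.v *)
From HB Require Import structures.
From mathcomp Require Import all_boot all_order all_algebra.
From mathcomp Require Import reals.

Set Implicit Arguments.
Unset Strict Implicit.
Unset Printing Implicit Defensive.

Import Order.TTheory GRing.Theory Num.Theory.

Local Open Scope ring_scope.

(* P_r(V): the subsets of V of cardinality at most r. *)
Notation psets V r := {I : {set V} | (#|I| <= r)%N}.

(* R^{P_r(V)}. *)
Notation psvec R V r := {ffun psets V r -> R}.

(* The coordinate x_I.  The value is 0 when #|I| > r, so that no cardinality
   proof has to be carried around; every definition below that is used with a
   vector of the size required of it only reads coordinates with #|I| <= r. *)
Definition ent (R : realType) (V : finType) (r : nat)
    (x : psvec R V r) (I : {set V}) : R :=
  if insub I is Some u then x u else 0.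

(* The standard unit vectors: e_0 is unitv set0 and e_i is unitv [set i]. *)
Definition unitv (R : realType) (V : finType) (I : {set V}) : psvec R V 1 :=
  [ffun J => (val J == I)%:R].

(* Matrices indexed by a finite type X are functions X -> X -> R. *)
Definition psd (R : realType) (X : finType) (A : X -> X -> R) : Prop :=
  (forall p q, A p q = A q p) /\
  (forall c : X -> R, 0 <= \sum_p \sum_q c p * A p q * c q).

Definition mulmv (R : realType) (V : finType)
    (A : psets V 1 -> psets V 1 -> R) (x : psvec R V 1) : psvec R V 1 :=
  [ffun I => \sum_J A I J * x J].

(* The multiset A(T) is the family of the sets S :|: I, indexed by the pairs
   (S, I) with S \subset T and I in P_1(V); repetitions are kept because the
   index type consists of the pairs, not of the unions. *)
Definition AT_index (V : finType) (T : {set V}) : finType :=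
  ({S : {set V} | S \subset T} * psets V 1)%type.

Definition AT_set (V : finType) (T : {set V}) (p : AT_index T) : {set V} :=
  val p.1 :|: val p.2.

(* M(T; z), meant for z in R^{P_r(V)} with #|T| + 2 <= r. *)
Definition MT (R : realType) (V : finType) (r : nat) (T : {set V})
    (z : psvec R V r) (p q : AT_index T) : R :=
  ent z (AT_set p :|: AT_set q).

(* The vector ay. *)
Definition shiftv (R : realType) (V : finType) (r : nat)
    (a : psvec R V 1) (y : psvec R V r.+1) : psvec R V r :=
  [ffun I => ent a set0 * ent y (val I)
             + \sum_(i : V) ent a [set i] * ent y (val I :|: [set i])].

(* K = { x | a_l^T x >= 0 for all l }. *)
Definition polyK (R : realType) (V : finType) (m : nat)
    (a : 'I_m -> psvec R V 1) (x : psvec R V 1) : Prop :=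
  forall l, 0 <= \sum_I a l I * x I.

Definition extends (R : realType) (V : finType) (r : nat)
    (x : psvec R V 1) (y : psvec R V r) : Prop :=
  ent y set0 = ent x set0 /\ forall i : V, ent y [set i] = ent x [set i].

(* L^t(K), meant for t >= 2 (subtraction on nat is truncated); it depends on
   the description a of K, not only on K itself. *)
Definition Lhier (R : realType) (V : finType) (m : nat)
    (a : 'I_m -> psvec R V 1) (t : nat) (x : psvec R V 1) : Prop :=
  exists y : psvec R V t.+1,
    [/\ extends x y,
        forall T : {set V}, #|T| = (t - 1)%N -> psd (MT (T := T) y) &
        forall (T : {set V}) (l : 'I_m),
          #|T| = (t - 2)%N -> psd (MT (T := T) (shiftv (a l) y))].

(* A_S(y): the entry at (I, J) in P_1(V) x P_1(V) is y_{S U I U J}, which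
   covers the cases y_S, y_{S U {i}} and y_{S U {i,j}} at once. *)
Definition AS (R : realType) (V : finType) (r : nat) (S : {set V})
    (y : psvec R V r) (I J : psets V 1) : R :=
  ent y (S :|: (val I :|: val J)).

Definition AST (R : realType) (V : finType) (r : nat) (S T : {set V})
    (y : psvec R V r) (I J : psets V 1) : R :=
  \sum_(S' : {set V} | (S \subset S') && (S' \subset T))
    (-1) ^+ #|S' :\: S| * AS S' y I J.

(* The hierarchy tilde L^t(K), meant for t >= 1. *)
Definition Ltilde (R : realType) (V : finType)
    (K : psvec R V 1 -> Prop) (t : nat) (x : psvec R V 1) : Prop :=
  exists y : psvec R V t.+1,
    [/\ extends x y,
        forall T : {set V}, #|T| = (t - 1)%N -> psd (MT (T := T) y) &
        forall (T S : {set V}) (i : V), #|T| = (t - 1)%N -> S \subset T ->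
          K (mulmv (AST S T y) (unitv R [set i])) /\
          K (mulmv (AST S T y) (unitv R set0 - unitv R [set i]))].

(* Main.v *)
Require Import Defs.
From mathcomp Require Import all_boot all_order all_algebra.
From mathcomp Require Import reals ring lra.

(** A vector y witnessing that x lies in the first relaxation, truncated to the
    sets of cardinality at most t+1, witnesses that x lies in the second.
    Positive semidefiniteness of M(T; y) for #|T| = t-1 is inherited from any T'
    containing T with one more element, because M(T; y) is a principal submatrix
    of M(T'; y); such a T' exists because t-1 < #|V|.

    The membership conditions come from the localizing matrices.  For S a subset
    of T, the signs e(A) = (-1)^#|A \ S| on the interval [S, T] satisfy
      sum_(A, B) e(A) e(B) f(A U B) = sum_A e(A) f(A)
    ([alternating_convolution]): for fixed A, a point of A outside S can be
    toggled in B without changing A U B, so that only A = S contributes.  Hence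
    the quadratic form of M(T; z) at a vector e(A) w(I) is that of A(S, T)(z) at
    w, and A(S, T)(z) is positive semidefinite as soon as M(T; z) is
    ([AST_psd]).

    Take z = a_l y.  Since a set J is absorbed by union with itself, the linear
    form a_l applied to the column J of A(S, T)(y) is the diagonal entry (J, J)
    of A(S, T)(z) ([sum_mulmv_AST]).  So a_l^T A(S, T)(y) e_i is a diagonal
    entry of a positive semidefinite matrix, and
    a_l^T A(S, T)(y) (e_0 - e_i) is a difference of two diagonal entries; the
    latter is the value of the quadratic form at e_0 - e_i, because the (0, i)
    and (i, i) entries of A(S, T)(z) coincide ([AST_diag_antimono]). *)

Import Order.TTheory GRing.Theory Num.Theory.

Local Open Scope ring_scope.

Section MomentMatrices.
Set Implicit Arguments.
Unset Strict Implicit.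
Context {R : realType} {V : finType}.
Implicit Types (S T A B : {set V}) (f : {set V} -> R).

(** * Alternating sums over an interval of sets *)

(** Toggling k is a sign-reversing involution of the interval [S, T]. *)
Lemma alternating_sum0 S T k f :
  k \in T -> k \notin S -> (forall A, f (k |: A) = f (A :\ k)) ->
  \sum_(A : {set V} | (S \subset A) && (A \subset T))
    (-1) ^+ #|A :\: S| * f A = 0.
Proof.
move=> kT kS fk.
(* The sets containing k are matched with those that do not. *)
rewrite (bigID (fun A : {set V} => k \in A)) /=.
rewrite (reindex_onto (fun A : {set V} => k |: A) (fun A => A :\ k)) /=;
  last first.
  by move=> A /andP[_ kA]; rewrite setD1K.
rewrite -[X in _ + X]opprK; apply/eqP; rewrite subr_eq0 -sumrN; apply/eqP.
apply: eq_big => [A|A /andP[_ /eqP kA]].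
  have [kA|kA] := boolP (k \in A).
    rewrite andbF; apply/negP => /andP[_ /eqP/setP/(_ k)].
    by rewrite setD11 kA.
  rewrite setU11 !andbT setU1K // eqxx andbT subUset sub1set kT /=.
  congr (_ && _); apply/idP/idP => [|]; last first.
    by move=> SA; apply: subset_trans SA (subsetUr _ _).
  move=> /subsetP SA; apply/subsetP => x xS; move: (SA x xS).
  by rewrite !inE => /orP[/eqP xk|//]; rewrite -xk xS in kS.
have {}kA : k \notin A by rewrite -kA setD11.
have -> : (k |: A) :\: S = k |: (A :\: S).
  by apply/setP => x; rewrite !inE; case: (eqVneq x k) => [->|]; rewrite ?kS.
rewrite cardsU1 !inE kS (negPf kA) /= exprD expr1 mulN1r mulNr fk.
have /setDidPl -> // : [disjoint A & [set k]].
by rewrite disjoint_sym disjoints1.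
Qed.

(** In the algebra where sets multiply by union, the signed sum over [S, T] is S
    times the product of the factors 1 - {k} for k in T outside S; each factor is
    idempotent, hence so is the signed sum. *)
Lemma alternating_convolution S T f : S \subset T ->
  \sum_(A : {set V} | (S \subset A) && (A \subset T))
    \sum_(B : {set V} | (S \subset B) && (B \subset T))
      (-1) ^+ #|A :\: S| * (-1) ^+ #|B :\: S| * f (A :|: B) =
  \sum_(A : {set V} | (S \subset A) && (A \subset T))
    (-1) ^+ #|A :\: S| * f A.
Proof.
move=> ST; rewrite (bigD1 S) ?subxx //= setDv cards0 expr0.
rewrite [X in _ + X]big1 ?addr0 => [|A /andP[/andP[SA AT] AS]].
  by apply: eq_bigr => B /andP[/setUidPr -> _]; rewrite mul1r.
have [k kA kS] : exists2 k, k \in A & k \notin S.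
  by apply/subsetPn; apply: contraNN AS => AS; rewrite eqEsubset AS.
under eq_bigr do rewrite -mulrA.
rewrite -mulr_sumr (@alternating_sum0 S T k (fun B => f (A :|: B))) ?mulr0 //.
  exact: (subsetP AT).
move=> B; congr f; apply/setP => x; rewrite !inE.
by case: (eqVneq x k) => [->|]; rewrite ?kA.
Qed.

(** * Matrices inheriting positive semidefiniteness *)

(** M(T; z) is tested on vectors that are products of the sign of A and of a
    vector on P_1(V); [alternating_convolution] merges the two sign factors of
    the quadratic form into the single one in the definition of A(S, T)(z). *)
Lemma AST_psd r S T (z : psvec R V r) :
  S \subset T -> psd (MT (T := T) z) -> psd (AST S T z).
Proof.
move=> ST [_ z_ge0]; split=> [I J|w].
  by apply: eq_bigr => A _; rewrite /AS [val I :|: _]setUC.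
(* The sign vector, extended by 0 to the subsets of T that do not contain S. *)
pose e (A : {set V}) : R := if S \subset A then (-1) ^+ #|A :\: S| else 0.
have := z_ge0 (fun p => e (val p.1) * w p.2); congr (0 <= _).
pose G (I J : psets V 1) A B : R :=
  e A * w I * (e B * w J) * ent z (A :|: B :|: (val I :|: val J)).
transitivity (\sum_(A : {S' : {set V} | S' \subset T}) \sum_(I : psets V 1)
   \sum_(B : {S' : {set V} | S' \subset T}) \sum_(J : psets V 1)
     G I J (val A) (val B)).
  rewrite [RHS]pair_bigA; apply: eq_bigr => -[A I] _; rewrite pair_bigA.
  apply: eq_bigr => -[B J] _.
  by rewrite /G /MT /AT_set /= setUACA; ring.
rewrite exchange_big; apply: eq_bigr => I _.
under eq_bigr do rewrite exchange_big.
rewrite exchange_big; apply: eq_bigr => J _ /=.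
have sumE (F : {set V} -> R) :
    \sum_(A : {S' : {set V} | S' \subset T}) e (val A) * F (val A) =
    \sum_(A : {set V} | (S \subset A) && (A \subset T)) (-1) ^+ #|A :\: S| * F A.
  rewrite -(big_sub [pred A : {set V} | A \subset T] (fun A => e A * F A)) /=.
  rewrite (bigID (fun A : {set V} => S \subset A)) /= [X in _ + X]big1.
    rewrite addr0; apply: eq_big => [A|A]; first by rewrite andbC.
    by rewrite /e => /andP[_ ->].
  by move=> A /andP[_ /negPf SA]; rewrite /e SA mul0r.
transitivity (w I * w J * \sum_(A : {S' : {set V} | S' \subset T}) e (val A) *
  \sum_(B : {S' : {set V} | S' \subset T}) e (val B) *
     ent z (val A :|: val B :|: (val I :|: val J))).
  rewrite mulr_sumr; apply: eq_bigr => A _; rewrite !mulr_sumr.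
  by apply: eq_bigr => B _; rewrite /G; ring.
rewrite (sumE (fun A => \sum_(B : {S' : {set V} | S' \subset T}) e (val B) *
     ent z (A :|: val B :|: (val I :|: val J)))).
under eq_bigr => A _.
  rewrite (sumE (fun B => ent z (A :|: B :|: (val I :|: val J)))) mulr_sumr.
  under eq_bigr do rewrite mulrA.
  over.
rewrite (@alternating_convolution S T (fun A => ent z (A :|: (val I :|: val J)))) //.
by rewrite /AST /AS mulrAC.
Qed.

(** Covers principal submatrices; for a map g that is not injective, a test
    vector is pushed forward by summing it over the fibres of g. *)
Lemma psd_reindex (X Y : finType) (g : X -> Y) (A : Y -> Y -> R) :
  psd A -> psd (fun p q => A (g p) (g q)).
Proof.
move=> [A_sym A_ge0]; split=> [p q|c]; first exact: A_sym.
have := A_ge0 (fun x => \sum_(p | g p == x) c p); congr (0 <= _).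
have sumE (F : Y -> R) :
    \sum_x (\sum_(p | g p == x) c p) * F x = \sum_p c p * F (g p).
  rewrite [RHS](partition_big g predT) //=; apply: eq_bigr => x _.
  by rewrite mulr_suml; apply: eq_bigr => p /eqP->.
transitivity (\sum_x (\sum_(p | g p == x) c p) *
    \sum_y (\sum_(p | g p == y) c p) * A x y).
  by apply: eq_bigr => x _; rewrite mulr_sumr; apply: eq_bigr => y _; ring.
rewrite sumE; apply: eq_bigr => p _; rewrite sumE mulr_sumr.
by apply: eq_bigr => q _; ring.
Qed.

(** * Vectors indexed by small sets *)

Lemma big_psets1 (F : {set V} -> R) :
  \sum_(I : psets V 1) F (val I) = F set0 + \sum_(i : V) F [set i].
Proof.
rewrite -(big_sub [pred I : {set V} | (#|I| <= 1)%N] F) /=.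
rewrite (bigD1 set0) /= ?inE ?cards0 //; congr (_ + _).
rewrite -(@big_imset _ _ _ _ _ set1 V F) /=; last first.
  by move=> i j _ _; exact: set1_inj.
apply: eq_bigl => I; apply/andP/imsetP => [[]|[i _ ->]].
  rewrite inE leq_eqVlt ltnS leqn0 cards_eq0 => /orP[/cards1P[i ->]|/eqP->].
    by exists i.
  by rewrite eqxx.
by rewrite inE cards1 -cards_eq0 cards1.
Qed.

Lemma entE r (y : psvec R V r) (I : psets V r) : ent y (val I) = y I.
Proof. by rewrite /ent valK. Qed.

Lemma ent_ffun r (F : {set V} -> R) (I : {set V}) :
  (#|I| <= r)%N -> ent [ffun J : psets V r => F (val J)] I = F I.
Proof. by move=> Ir; rewrite /ent insubT /= ffunE. Qed.

Lemma ent_shiftv r (a : psvec R V 1) (y : psvec R V r.+1) (I : {set V}) :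
  (#|I| <= r)%N ->
  ent (shiftv a y) I = \sum_(J : psets V 1) a J * ent y (I :|: val J).
Proof.
move=> Ir; rewrite /shiftv.
rewrite (@ent_ffun _ (fun I => ent a set0 * ent y I
  + \sum_i ent a [set i] * ent y (I :|: [set i]))) //.
under [RHS]eq_bigr do rewrite -entE.
by rewrite (big_psets1 (fun J => ent a J * ent y (I :|: J))) setU0.
Qed.

Lemma card_setU_psets1 r S (I : psets V 1) :
  (#|S| <= r)%N -> (#|S :|: val I| <= r.+1)%N.
Proof.
move=> Sr; apply: leq_trans (leq_card_setU _ _).1 _.
by rewrite -[r.+1]addn1 (leq_add Sr (valP I)).
Qed.

(** * Diagonal entries and quadratic forms *)

Lemma sum_pick (X : finType) (p : X) (F : X -> R) :
  \sum_x (x == p)%:R * F x = F p.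
Proof.
rewrite (bigD1 p) //= eqxx mul1r big1 ?addr0 // => x /negPf ->.
by rewrite mul0r.
Qed.

Lemma psd_diag (X : finType) (A : X -> X -> R) p : psd A -> 0 <= A p p.
Proof.
move=> [_ /(_ (fun x => (x == p)%:R))]; congr (0 <= _).
under eq_bigr => x _.
  under eq_bigr => y _ do rewrite mulrC.
  rewrite sum_pick; over.
exact: sum_pick.
Qed.

Lemma psd_diff (X : finType) (A : X -> X -> R) p q :
  psd A -> 0 <= A p p - A p q *+ 2 + A q q.
Proof.
move=> [A_sym /(_ (fun x => (x == p)%:R - (x == q)%:R))]; congr (0 <= _).
transitivity (\sum_x ((x == p)%:R * (A x p - A x q)
                     - (x == q)%:R * (A x p - A x q))).
  apply: eq_bigr => x _.
  rewrite -mulrBl -(sum_pick p) -(sum_pick q) -sumrB mulr_sumr.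
  by apply: eq_bigr => y _; ring.
by rewrite sumrB !sum_pick (A_sym q p); ring.
Qed.

Lemma sum_unitv (I : {set V}) (I1 : (#|I| <= 1)%N) (F : psets V 1 -> R) :
  \sum_J unitv R I J * F J = F (Sub I I1).
Proof.
by rewrite -(sum_pick (Sub I I1)); apply: eq_bigr => J _; rewrite ffunE -val_eqE.
Qed.

(** If J contains I, the (I, J) entry equals the (J, J) entry, so the quadratic
    form at e_I - e_J collapses to the difference of the diagonal entries. *)
Lemma AST_diag_antimono r S T (z : psvec R V r) (I J : psets V 1) :
  val I \subset val J -> psd (AST S T z) ->
  AST S T z J J <= AST S T z I I.
Proof.
move=> /setUidPr IJ /(psd_diff I J).
have -> : AST S T z I J = AST S T z J J.
  by apply: eq_bigr => A _; rewrite /AS IJ setUid.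
lra.
Qed.

(** Entry (I, J) of [AST S T y] reads y at A U I U J; summing it against a over
    I gives (ay) at A U J = A U J U J, hence the diagonal entry on the right.  The
    bound on T keeps every A U J inside the range where ay is defined. *)
Lemma sum_mulmv_AST r S T (a : psvec R V 1) (y : psvec R V r.+2) (v : psvec R V 1) :
  (#|T| <= r)%N ->
  \sum_I a I * mulmv (AST S T y) v I = \sum_J v J * AST S T (shiftv a y) J J.
Proof.
move=> Tr; under eq_bigr => I _ do rewrite ffunE mulr_sumr.
rewrite exchange_big; apply: eq_bigr => J _ /=.
under eq_bigr => I _ do rewrite mulrA mulrC.
rewrite -mulr_sumr; congr (_ * _).
under eq_bigr => I _ do rewrite mulr_sumr.
rewrite exchange_big; apply: eq_bigr => A /andP[_ AT] /=.
rewrite /AS setUid ent_shiftv; last first.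
  by rewrite card_setU_psets1 // (leq_trans (subset_leq_card AT)).
rewrite mulr_sumr; apply: eq_bigr => I _.
by rewrite -setUA [val J :|: _]setUC; ring.
Qed.

(** * Truncation *)

Definition restrict r r' (y : psvec R V r) : psvec R V r' :=
  [ffun I => ent y (val I)].

Lemma ent_restrict r r' (y : psvec R V r) (I : {set V}) :
  (#|I| <= r')%N -> ent (restrict r' y) I = ent y I.
Proof. exact: ent_ffun. Qed.

Lemma superset_cardS T :
  (#|T| < #|V|)%N -> exists2 T' : {set V}, T \subset T' & #|T'| = #|T|.+1.
Proof.
move=> TV; have : ~~ ([set: V] \subset T).
  by apply/negP => /subset_leq_card; rewrite cardsT leqNgt TV.
by move=> /subsetPn[k _ kT]; exists (k |: T); rewrite ?subsetUr // cardsU1 kT.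
Qed.

Lemma MT_restrict_psd r r' (T T' : {set V}) (y : psvec R V r) :
  (#|T|.+2 <= r')%N -> T \subset T' ->
  psd (MT (T := T') y) -> psd (MT (T := T) (restrict r' y)).
Proof.
move=> Tr TT' ypsd.
pose g (p : AT_index T) : AT_index T' :=
  (Sub (val p.1) (subset_trans (valP p.1) TT'), p.2).
have [sym ge0] := psd_reindex g ypsd.
have E p q : MT (T := T) (restrict r' y) p q = MT y (g p) (g q).
  rewrite /MT ent_restrict //; apply: leq_trans Tr.
  rewrite /AT_set setUACA setUA !card_setU_psets1 // subset_leq_card //.
  by rewrite subUset (valP p.1) (valP q.1).
split=> [p q|c]; first by rewrite !E sym.
by under eq_bigr => p _ do under eq_bigr => q _ do rewrite E; apply: ge0.
Qed.

Lemma AST_restrict r r' S T (y : psvec R V r) (I J : psets V 1) :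
  (#|T|.+2 <= r')%N -> AST S T (restrict r' y) I J = AST S T y I J.
Proof.
move=> Tr; apply: eq_bigr => A /andP[_ AT]; rewrite /AS ent_restrict //.
apply: leq_trans Tr.
by rewrite setUA !card_setU_psets1 // subset_leq_card.
Qed.

End MomentMatrices.

Theorem proposition2p6 (R : realType) (V : finType) (n : nat) (hn : #|V| = n)
    (m : nat) (a : 'I_m -> psvec R V 1)
    (hK : forall x : psvec R V 1, polyK a x ->
            forall i : V, 0 <= ent x [set i] <= ent x set0)
    (t : nat) (ht1 : (1 <= t)%N) (htn : (t + 1 <= n + 1)%N)
    (x : psvec R V 1) :
  Lhier a (t + 1) x -> Ltilde (polyK a) t x.
Proof.
move: (t) ht1 htn => [//|r] _; rewrite !addn1 ltnS => rn [y [[y0 y1] ypsd aypsd]].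
exists (restrict _ y); split.
- by split=> [|i]; rewrite ent_restrict ?cards0 ?cards1.
- rewrite subn1 /= => T Tr.
  have [|T' TT' T'r] := @superset_cardS V T; first by rewrite Tr hn.
  by apply: MT_restrict_psd TT' (ypsd _ _); rewrite ?Tr // T'r Tr subn1.
rewrite subn1 /= => T S i Tr ST.
have E v l : \sum_I a l I * mulmv (AST S T (restrict r.+2 y)) v I =
    \sum_J v J * AST S T (shiftv (a l) y) J J.
  rewrite -sum_mulmv_AST ?Tr //; apply: eq_bigr => I _; congr (_ * _).
  by rewrite !ffunE; apply: eq_bigr => J _; rewrite AST_restrict ?Tr.
have I0 : (#|set0 : {set V}| <= 1)%N by rewrite cards0.
have I1 : (#|[set i]| <= 1)%N by rewrite cards1.
have zpsd l : psd (AST S T (shiftv (a l) y)).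
  by apply/AST_psd/aypsd; rewrite // subn2.
split=> l; rewrite E; first by rewrite (sum_unitv I1); apply: psd_diag.
have unitvB (J : psets V 1) :
    (unitv R set0 - unitv R [set i]) J = unitv R set0 J - unitv R [set i] J.
  by rewrite !ffunE.
under eq_bigr => J _ do rewrite unitvB mulrBl.
rewrite sumrB (sum_unitv I0) (sum_unitv I1) subr_ge0.
exact/AST_diag_antimono/zpsd/sub0set.
Qed.
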